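(* Let $r\ge 3$ and let $\mathcal{H}$ be an $r$-uniform $r$-partite linear hypergraph which contains no rainbow cycles of length three or four. If $A_1,\dots,A_6$ are six distinct edges of $\mathcal{H}$ with $|A_1\cup\cdots\cup A_6|\le 6r-9$, then $|A_1\cup\cdots\cup A_6|=6r-9$ and $A_1,\dots,A_6$ have only one possible configuration up to isomorphism, namely a $3\times 3$ grid: after relabeling, $A_1,A_2,A_3$ are pairwise disjoint, $A_4,A_5,A_6$ are pairwise disjoint, $|A_i\cap A_j|=1$ for all $i\in\{1,2,3\}$, $j\in\{4,5,6\}$, these nine intersection vertices are pairwise distinct, and every other vertex of $A_1\cup\cdots\cup A_6$ lies in exactly one of the six edges.
   Context: A hypergraph is linear if any two distinct edges share at most one vertex. An $r$-uniform hypergraph is $r$-partite if its vertex set is partitioned into $r$ parts $V_1,\dots,V_r$ such that every edge contains exactly one vertex of each part. A cycle of length $k$ is a sequence $v_1,A_1,\dots,v_k,A_k,v_1$ of distinct vertices and distinct edges with $v_i,v_{i+1}\in A_i$ ($1\le i\le k-1$) and $v_k,v_1\in A_k$; it is a rainbow $k$-cycle if $v_1,\dots,v_k$ lie in pairwise different parts. *)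

(* Defs.v *)
From HB Require Import structures.
From mathcomp Require Import all_boot all_fingroup.

Set Implicit Arguments.
Unset Strict Implicit.
Unset Printing Implicit Defensive.

(* A hypergraph on the finite vertex set V is its set E : {set {set V}} of    *)
(* edges. A partition of V into parts V_1, ..., V_r is given by the map       *)
(* part : V -> 'I_r sending each vertex to the index of its part.             *)

Definition uniform (V : finType) (r : nat) (E : {set {set V}}) : Prop :=
  forall A, A \in E -> #|A| = r.

Definition partite (V : finType) (r : nat) (part : V -> 'I_r)
    (E : {set {set V}}) : Prop :=
  forall A, A \in E -> forall s : 'I_r, #|[set v in A | part v == s]| = 1.

Definition linear_hypergraph (V : finType) (E : {set {set V}}) : Prop :=
  forall A B, A \in E -> B \in E -> A != B -> #|A :&: B| <= 1.

(* ordS is the cyclic successor on 'I_k, so the last edge contains the last   *)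
(* and the first vertex.                                                      *)
Definition hcycle (V : finType) (E : {set {set V}}) (k : nat)
    (v : 'I_k -> V) (A : 'I_k -> {set V}) : Prop :=
  [/\ injective v, injective A, forall i, A i \in E
    & forall i, v i \in A i /\ v (ordS i) \in A i].

Definition rainbow_cycle (V : finType) (r : nat) (part : V -> 'I_r)
    (E : {set {set V}}) (k : nat) (v : 'I_k -> V) (A : 'I_k -> {set V}) : Prop :=
  hcycle E v A /\ injective (fun i => part (v i)).

Definition has_rainbow_cycle (V : finType) (r : nat) (part : V -> 'I_r)
    (E : {set {set V}}) (k : nat) : Prop :=
  exists (v : 'I_k -> V) (A : 'I_k -> {set V}), rainbow_cycle part E v A.

(* The rows are B 0, B 1, B 2 and the columns are C 0, C 1, C 2.              *)
Definition grid33_lines (V : finType) (B C : 'I_3 -> {set V}) : Prop :=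
  [/\ forall i i', i != i' -> [disjoint B i & B i'],
      forall j j', j != j' -> [disjoint C j & C j'],
      forall i j, #|B i :&: C j| = 1,
      forall i j i' j' x, x \in B i :&: C j -> x \in B i' :&: C j' ->
        (i, j) = (i', j')
    & forall x, x \in (\bigcup_i B i) :|: (\bigcup_j C j) ->
        (forall i j, x \notin B i :&: C j) ->
        #|[set i | x \in B i]| + #|[set j | x \in C j]| = 1].

(* The permutation s is the relabeling; 'I_6 is read as 'I_(3 + 3), whose     *)
(* first three indices give the rows and last three the columns.              *)
Definition grid33 (V : finType) (A : 'I_6 -> {set V}) : Prop :=
  exists s : {perm 'I_6},
    grid33_lines (fun i : 'I_3 => A (s (@lshift 3 3 i)))
                 (fun j : 'I_3 => A (s (@rshift 3 3 j))).

(* Main.v *)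
(* Call x a crossing of two of the six edges A_i if it lies in both. Two       *)
(* vertices of one edge lie in different parts, so every 3-cycle of H is       *)
(* rainbow; hence three pairwise crossing edges pass through one vertex.       *)
(* Choose for every covered vertex x one index c x with x in A_(c x), and join *)
(* i and j if A_i and A_j cross at some x with c x = i or c x = j: each x of   *)
(* multiplicity d becomes a star with d - 1 edges. This graph on six vertices  *)
(* is triangle-free and has 6r - |A_1 u ... u A_6| >= 9 edges, so it is K_3,3  *)
(* by Mantel's theorem. A vertex x on two edges of the same side would be the  *)
(* crossing of both with each of the three edges of the other side, and c x    *)
(* would have to be all three of these.                                        *)
Require Import Defs.
From HB Require Import structures.
From mathcomp Require Import all_boot all_fingroup.
From mathcomp Require Import zify.

Set Implicit Arguments.
Unset Strict Implicit.
Unset Printing Implicit Defensive.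

(** Equality case of Mantel's theorem on 2n vertices. The degree sum counts each edge twice, so
    [2 * n ^ 2] stands for n^2 edges. *)
Lemma mantel_extremal (T : finType) (n : nat) (e : rel T) :
    symmetric e -> (forall x y z, e x y -> e y z -> e x z -> False) ->
    0 < n -> #|T| = 2 * n -> 2 * n ^ 2 <= \sum_x #|[set y | e x y]| ->
  \sum_x #|[set y | e x y]| = 2 * n ^ 2 /\
  exists N : {set T}, [/\ #|N| = n, #|~: N| = n
    & forall x y, e x y = (x \in N) (+) (y \in N)].
Proof.
move=> e_sym e_tri n_gt0 cardT.
pose nb x := [set y | e x y]; set S := \sum_x _ => le_sum.
(* Let N be the neighbourhood of a vertex of maximal degree D. It is           *)
(* independent, so every edge has an end outside N, and there are at most      *)
(* (2n - D) D <= n^2 edges; equality makes every vertex outside N adjacent to  *)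
(* all of N.                                                                   *)
have /card_gt0P[v0 _] : 0 < #|T| by rewrite cardT; lia.
have [v _ max_v] := @arg_maxnP T v0 predT (fun x => #|nb x|) isT.
set N := nb v in max_v; set D := #|N| in max_v.
have cardNC : #|~: N| = 2 * n - D by rewrite cardsCs setCK cardT.
have D_le : D <= 2 * n by rewrite -cardT max_card.
have nbN x : x \in N -> nb x \subset ~: N.
  rewrite inE => vx; apply/subsetP=> y; rewrite !inE => xy.
  by apply/negP=> vy; apply: (e_tri v x y).
(* The left side counts the edges between N and its complement from the N side; the right side also
   counts those inside the complement. *)
have sumN : \sum_(x in N) #|nb x| <= \sum_(x in ~: N) #|nb x|.
  have -> : \sum_(x in N) #|nb x| = \sum_(x in N) \sum_(y in ~: N) e x y.
    apply: eq_bigr => x xN; rewrite -sum1_card big_mkcond [RHS]big_mkcond /=.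
    apply: eq_bigr => y _; have := subsetP (nbN x xN) y.
    by rewrite !inE; case: (e x y) => [->|_] //; case: ifP.
  rewrite exchange_big /=; apply: leq_sum => y _.
  rewrite -sum1_card big_mkcond [X in _ <= X]big_mkcond /=.
  by apply: leq_sum => x _; rewrite !inE (e_sym y); case: ifP; case: (e x y).
have sumNC : \sum_(x in ~: N) #|nb x| <= (2 * n - D) * D.
  by rewrite -cardNC -sum_nat_const; apply: leq_sum => x _; apply: max_v.
have split_sum :
    S = \sum_(x in N) #|nb x| + \sum_(x in ~: N) #|nb x|.
  rewrite /S (bigID (mem N)) /=; congr (_ + _).
  by apply: eq_bigl => x; rewrite in_setC.
(* With truncated subtraction, [D - n + (n - D)] is |D - n|. As the degree sum is at most 2(2n -
   D)D, this identity forces D = n. *)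
have gap : (2 * n - D) * D + (D - n + (n - D)) ^ 2 = n ^ 2.
  have [leDn|/ltnW lenD] := leqP D n.
    have [k ->] : exists k, n = D + k by exists (n - D); lia.
    have -> : 2 * (D + k) - D = D + 2 * k by lia.
    have -> : D - (D + k) + (D + k - D) = k by lia.
    by lia.
  have [k DE] : exists k, D = 2 * n - k by exists (2 * n - D); lia.
  have [l nE] : exists l, n = k + l by exists (D - n); lia.
  have -> : D - n + (n - D) = l by lia.
  have -> : 2 * n - D = k by lia.
  have -> : D = k + 2 * l by lia.
  by rewrite nE; lia.
have D_n : D = n.
  have : (D - n + (n - D)) ^ 2 = 0 by lia.
  by move/eqP; rewrite expn_eq0 /= => /eqP; lia.
have sumN_n : \sum_(x in N) #|nb x| = \sum_(x in N) n.
  rewrite sum_nat_const -/D D_n; rewrite D_n in sumNC.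
  have E2 : (2 * n - n) * n = n * n by congr (_ * n); lia.
  by rewrite split_sum in le_sum; lia.
have nb_n x : #|nb x| <= n by rewrite -D_n; apply: max_v.
have nbN_E x : x \in N -> nb x = ~: N.
  move=> xN; apply/eqP; rewrite eqEcard nbN // cardNC D_n.
  rewrite leqNgt; apply/negP => lt_n.
  suff : \sum_(y in N) #|nb y| < \sum_(y in N) n by rewrite sumN_n ltnn.
  rewrite (bigD1 x) //= [X in _ < X](bigD1 x) //= -addSn.
  by apply: leq_add; [lia | apply: leq_sum => y _].
have nbNC_E x : x \notin N -> nb x = N.
  move=> xN; apply/esym/eqP; rewrite eqEcard -/D D_n nb_n andbT.
  apply/subsetP=> y yN; rewrite inE e_sym.
  by have := nbN_E y yN => /setP/(_ x); rewrite !inE => ->; rewrite inE in xN.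
split.
  rewrite split_sum sumN_n sum_nat_const -/D D_n; rewrite split_sum in le_sum.
  by lia.
exists N; split=> //; first by rewrite cardNC; lia.
move=> x y; have -> : e x y = (y \in nb x) by rewrite inE.
by case: (boolP (x \in N)) => xN; [rewrite nbN_E // inE | rewrite nbNC_E].
Qed.

Lemma same_part_eq (r : nat) (V : finType) (part : V -> 'I_r)
    (E : {set {set V}}) (P : {set V}) (x y : V) :
  partite part E -> P \in E -> x \in P -> y \in P -> part x = part y -> x = y.
Proof.
move=> Epart PE xP yP eq_xy.
have /eqP/cards1P[z Pz] := Epart P PE (part x).
have : x \in [set z] by rewrite -Pz inE xP eqxx.
have : y \in [set z] by rewrite -Pz inE yP eq_xy eqxx.
by rewrite !inE => /eqP-> /eqP->.
Qed.

Lemma linear_eq (V : finType) (E : {set {set V}}) (P Q : {set V}) (x y : V) :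
  linear_hypergraph E -> P \in E -> Q \in E -> P != Q ->
  x \in P -> x \in Q -> y \in P -> y \in Q -> x = y.
Proof.
move=> Elin PE QE PQ xP xQ yP yQ.
by have /card_le1_eqP := Elin P Q PE QE PQ; apply; rewrite inE ?xP ?yP.
Qed.

Lemma pairwise_crossing_eq (r : nat) (V : finType) (part : V -> 'I_r)
    (E : {set {set V}}) (P Q R : {set V}) (x y z : V) :
    partite part E -> linear_hypergraph E -> ~ has_rainbow_cycle part E 3 ->
    P \in E -> Q \in E -> R \in E -> P != Q -> Q != R -> P != R ->
    x \in P -> x \in Q -> y \in Q -> y \in R -> z \in R -> z \in P ->
  x = y /\ x = z.
Proof.
move=> Epart Elin no3 PE QE RE PQ QR PR xP xQ yQ yR zR zP.
(* A coincidence of two crossings lies on all three edges, and linearity then identifies the third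
   with it. Otherwise x, Q, y, R, z, P is a 3-cycle. *)
have [exy|nxy] := eqVneq x y.
  by split=> //; apply: (linear_eq Elin PE RE PR) => //; rewrite exy.
have [exz|nxz] := eqVneq x z.
  by split=> //; apply: (linear_eq Elin QE RE QR) => //; rewrite exz.
have [eyz|nyz] := eqVneq y z.
  have : x = y by apply: (linear_eq Elin PE QE PQ) => //; rewrite eyz.
  by move=> exy; rewrite exy eqxx in nxy.
case: no3; exists (tnth [tuple x; y; z]), (tnth [tuple Q; R; P]).
have distinct (a b : V) (S : {set V}) :
    S \in E -> a \in S -> b \in S -> a != b -> part a != part b.
  by move=> SE aS bS; apply: contra_neq; apply: same_part_eq SE aS bS.
split; [split |].
- by apply/tuple_uniqP; rewrite /= !inE negb_or nxy nxz nyz.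
- by apply/tuple_uniqP; rewrite /= !inE negb_or QR !(eq_sym _ P) PQ PR.
- by case=> [[|[|[|//]]] lti]; rewrite (tnth_nth P).
- by case=> [[|[|[|//]]] lti]; rewrite !(tnth_nth x) !(tnth_nth P).
have /tuple_uniqP inj : uniq (map_tuple part [tuple x; y; z]).
  rewrite /= !inE negb_or (distinct x y Q) // (distinct y z R) //.
  by rewrite (distinct x z P).
by move=> i j eq_part; apply: inj; rewrite !tnth_map.
Qed.

Section SixEdges.

Variables (r : nat) (V : finType) (part : V -> 'I_r) (E : {set {set V}}).
Variable A : 'I_6 -> {set V}.
Hypotheses (Euni : uniform r E) (Epart : partite part E).
Hypotheses (Elin : linear_hypergraph E) (no3 : ~ has_rainbow_cycle part E 3).
Hypotheses (injA : injective A) (AE : forall i, A i \in E).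

Let neqA i j : i != j -> A i != A j. Proof. by rewrite inj_eq. Qed.

Let c (x : V) : 'I_6 := odflt ord0 [pick i | x \in A i].

Let c_mem x i : x \in A i -> x \in A (c x).
Proof. by rewrite /c; case: pickP => //= -> . Qed.

(** The star of x, oriented away from its centre [c x]; [e] forgets the orientation. *)
Let d (i j : 'I_6) := [exists x, [&& x \in A i, x \in A j, i != j & c x == i]].

Let e (i j : 'I_6) := d i j || d j i.

Let eP i j : e i j ->
  exists x, [/\ x \in A i, x \in A j, i != j & c x = i \/ c x = j].
Proof.
case/orP=> /existsP[x /and4P[xi xj ij /eqP cx]]; exists x; split=> //; auto.
by rewrite eq_sym.
Qed.

Let crossing_eq i j k x y z :
    i != j -> j != k -> i != k -> x \in A i -> x \in A j ->
    y \in A j -> y \in A k -> z \in A k -> z \in A i ->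
  x = y /\ x = z.
Proof.
move=> ij jk ik.
by apply: (pairwise_crossing_eq Epart Elin no3); rewrite ?AE ?neqA.
Qed.

(** The three crossings coincide in some x, and [c x] would lie in {i, j}, {j, k} and {i, k} at
    once. *)
Let e_triangle_free i j k : e i j -> e j k -> e i k -> False.
Proof.
move=> /eP[x [xi xj ij cx]] /eP[y [yj yk jk cy]] /eP[z [zi zk ik cz]].
have [exy exz] := crossing_eq ij jk ik xi xj yj yk zk zi.
rewrite -exy in cy; rewrite -exz in cz.
move/eqP: ij => ij; move/eqP: jk => jk; move/eqP: ik => ik.
by case: cx cy cz => cx [] cy [] cz; congruence.
Qed.

(** By linearity, [c] is injective on the vertices of [A j] assigned to other edges: two with the
    same value i would both lie in [A i] and [A j]. *)
Let card_d j : #|[set i | d i j]| = #|[set x in A j | c x != j]|.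
Proof.
have <- : c @: [set x in A j | c x != j] = [set i | d i j].
  apply/setP=> i; rewrite inE; apply/imsetP/existsP.
    case=> x; rewrite inE => /andP[xj cxj ->].
    by exists x; rewrite (c_mem xj) xj cxj eqxx.
  case=> x /and4P[xi xj ij /eqP cx]; exists x => //.
  by rewrite inE xj cx ij.
apply: card_in_imset => x y; rewrite !inE => /andP[xj cxj] /andP[yj cyj] exy.
apply: (linear_eq Elin (AE (c x)) (AE j)); rewrite ?neqA ?(c_mem xj) //.
by rewrite exy (c_mem yj).
Qed.

(** Each covered vertex is assigned to exactly one edge, so the assigned vertices of the six edges
    partition the union; [card_d] counts the remaining incidences. *)
Let card_cover : #|\bigcup_i A i| + \sum_j #|[set i | d i j]| = 6 * r.
Proof.
have -> : #|\bigcup_i A i| = \sum_j #|[set x in A j | c x == j]|.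
  rewrite -sum1_card (partition_big c predT) //=.
  apply: eq_bigr => j _; rewrite -sum1_card; apply: eq_bigl => x.
  rewrite inE; apply/andP/andP=> [[/bigcupP[i _ xi] /eqP<-]|[xj ->]].
    by rewrite (c_mem xi).
  by split=> //; apply/bigcupP; exists j.
have -> : 6 * r = \sum_(j < 6) r by rewrite sum_nat_const card_ord.
rewrite -big_split /=; apply: eq_bigr => j _.
rewrite card_d -(Euni (AE j)) -(cardsID [set x | c x == j] (A j)).
by congr (_ + _); apply: eq_card => x; rewrite !inE // andbC.
Qed.

Let sum_deg : \sum_i #|[set j | e i j]| = 2 * \sum_j #|[set i | d i j]|.
Proof.
(* By linearity [A i] and [A j] cross only once, so each edge of [e] has exactly one orientation in
   [d]. *)
have d_asym i j : d i j -> d j i -> False.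
  move=> /existsP[x /and4P[xi xj ij /eqP cx]] /existsP[y].
  case/and4P=> yj yi _ /eqP cy.
  have exy := linear_eq Elin (AE i) (AE j) (neqA ij) xi xj yi yj.
  by rewrite -cx -cy exy eqxx in ij.
have swap : \sum_i #|[set j | d i j]| = \sum_j #|[set i | d i j]|.
  under eq_bigr do rewrite cardsE -sum1_card big_mkcond.
  rewrite exchange_big /=; apply: eq_bigr => j _.
  by rewrite cardsE -sum1_card [RHS]big_mkcond.
rewrite mul2n -addnn -[X in _ = X + _]swap -big_split /=.
apply: eq_bigr => i _; rewrite -cardsUI [X in _ = _ + X](_ : _ = 0).
  by rewrite addn0; apply: eq_card => j; rewrite !inE.
apply/eqP; rewrite cards_eq0; apply/eqP/setP=> j; rewrite !inE.
by apply/negP=> /andP[]; apply: d_asym.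
Qed.

Let bipartite_disjoint (N : {set 'I_6}) i j :
    (forall i j, e i j = (i \in N) (+) (j \in N)) -> #|N| = 3 -> #|~: N| = 3 ->
    (i \in N) = (j \in N) -> i != j ->
  [disjoint A i & A j].
Proof.
move=> eN cardN cardNC eNij ij; apply/pred0P => x /=.
apply/negP => /andP[xi xj].
(* Since k is joined to i and j, all three edges cross at x only; [c x] is then in {i, k} and in {j,
   k}, hence equals k. *)
have c_other k : (k \in N) != (i \in N) -> c x = k.
  move=> ki.
  have /eP[y [yi yk ik cy]] : e i k by rewrite eN -negb_eqb eq_sym.
  have /eP[z [zj zk jk cz]] : e j k by rewrite eN -eNij -negb_eqb eq_sym.
  have [exz exy] := crossing_eq ij jk ik xi xj zj zk yk yi.
  move: cy cz; rewrite -exy -exz => -[] cxi [] cxj //.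
  by rewrite -cxi -cxj eqxx in ij.
have : 1 < #|[set k | (k \in N) != (i \in N)]|.
  case: (boolP (i \in N)) => iN.
    rewrite (_ : [set k | _] = ~: N) ?cardNC //.
    by apply/setP=> k; rewrite !inE; case: (k \in N).
  rewrite (_ : [set k | _] = N) ?cardN //.
  by apply/setP=> k; rewrite !inE; case: (k \in N).
case/card_gt1P=> k [l [kS lS /eqP[]]]; rewrite !inE in kS lS.
by rewrite -(c_other k) // -(c_other l).
Qed.

Lemma six_edges_extremal : #|\bigcup_i A i| <= 6 * r - 9 -> 3 <= r ->
  #|\bigcup_i A i| = 6 * r - 9 /\
  exists N : {set 'I_6}, [/\ #|N| = 3, #|~: N| = 3,
    forall i j, (i \in N) = (j \in N) -> i != j -> [disjoint A i & A j]
    & forall i j, i \in N -> j \notin N -> #|A i :&: A j| = 1].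
Proof.
move=> le_cover r_ge3; have cover := card_cover.
have e_sym : symmetric e by move=> i j; rewrite /e orbC.
have [//||sum_e [N [cardN cardNC eN]]] :=
  mantel_extremal e_sym e_triangle_free (n := 3) isT.
- by rewrite card_ord.
(* The degree sum is 2(6r - |union|), at least 18 = 2 * 3^2; [3 <= r] keeps [6 * r - 9] from being
   truncated. *)
- by rewrite sum_deg; lia.
split; first by rewrite sum_deg in sum_e; lia.
exists N; split=> // [i j|i j iN jN]; first exact: bipartite_disjoint.
have /eP[x [xi xj ij _]] : e i j by rewrite eN iN (negPf jN).
apply/eqP; rewrite eqn_leq Elin ?neqA //.
by apply/card_gt0P; exists x; rewrite inE xi.
Qed.

End SixEdges.

(** Provides the relabeling: enumerate N on the left half of the indices and its complement on the
    right half. *)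
Lemma perm_of_half_set (n : nat) (N : {set 'I_(n + n)}) :
  #|N| = n -> #|~: N| = n ->
  exists s : {perm 'I_(n + n)},
    (forall i : 'I_n, s (lshift n i) \in N) /\
    (forall j : 'I_n, s (rshift n j) \notin N).
Proof.
move=> cardN cardNC.
pose f (k : 'I_(n + n)) := match split k with
  | inl i => enum_val (cast_ord (esym cardN) i)
  | inr j => enum_val (cast_ord (esym cardNC) j) end.
have fl i : f (lshift n i) \in N.
  by rewrite /f -[lshift n i]/(unsplit (inl i)) unsplitK; apply: enum_valP.
have fr j : f (rshift n j) \notin N.
  rewrite /f -[rshift n j]/(unsplit (inr j)) unsplitK -in_setC.
  exact: enum_valP.
have f_inj : injective f.
  move=> k l; case: (split_ordP k) => i ->; case: (split_ordP l) => j -> eq_f.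
  - move: eq_f; rewrite /f -![lshift n _]/(unsplit (inl _)) !unsplitK.
    by move/enum_val_inj/cast_ord_inj->.
  - by have := fr j; rewrite -eq_f fl.
  - by have := fr i; rewrite eq_f fl.
  - move: eq_f; rewrite /f -![rshift n _]/(unsplit (inr _)) !unsplitK.
    by move/enum_val_inj/cast_ord_inj->.
by exists (perm f_inj); split=> i; rewrite permE.
Qed.

(** Disjointness within each family lets a vertex determine its row and its column, so crossings are
    distinct; a covered vertex that is no crossing has only one of the two. *)
Lemma grid33_lines_of_disjoint (V : finType) (B C : 'I_3 -> {set V}) :
    (forall i i', i != i' -> [disjoint B i & B i']) ->
    (forall j j', j != j' -> [disjoint C j & C j']) ->
    (forall i j, #|B i :&: C j| = 1) ->
  grid33_lines B C.
Proof.
move=> disjB disjC cardBC.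
have uniq_idx (D : 'I_3 -> {set V}) i i' x :
    (forall i i', i != i' -> [disjoint D i & D i']) ->
    x \in D i -> x \in D i' -> i = i'.
  move=> disjD xi xi'; apply: contraTeq xi' => /disjD/disjointFr-> //.
have card_idx (D : 'I_3 -> {set V}) i x :
    (forall i i', i != i' -> [disjoint D i & D i']) ->
    x \in D i -> #|[set k | x \in D k]| = 1.
  move=> disjD xi; apply/eqP/cards1P; exists i; apply/setP=> k; rewrite !inE.
  by apply/idP/eqP=> [xk|-> //]; apply: uniq_idx disjD xk xi.
have card_idx0 (D : 'I_3 -> {set V}) x :
    (forall k, x \notin D k) -> #|[set k | x \in D k]| = 0.
  move=> xD; apply/eqP; rewrite cards_eq0; apply/eqP/setP=> k.
  by rewrite !inE (negPf (xD k)).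
split=> // [i j i' j' x|x].
  rewrite !inE => /andP[xi xj] /andP[xi' xj'].
  by rewrite (uniq_idx B i i' x) // (uniq_idx C j j' x).
rewrite inE => /orP[] /bigcupP[k _ xk] not_crossing.
  rewrite (card_idx B k) // card_idx0 // => j.
  by have := not_crossing k j; rewrite inE xk.
rewrite (card_idx C k) // card_idx0 // => i.
by have := not_crossing i k; rewrite inE xk andbT.
Qed.

Theorem theorem14 (r : nat) (V : finType) (part : V -> 'I_r)
    (E : {set {set V}}) (A : 'I_6 -> {set V}) :
  3 <= r ->
  uniform r E ->
  partite part E ->
  linear_hypergraph E ->
  ~ has_rainbow_cycle part E 3 ->
  ~ has_rainbow_cycle part E 4 ->
  injective A ->
  (forall i, A i \in E) ->
  #|\bigcup_i A i| <= 6 * r - 9 ->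
  #|\bigcup_i A i| = 6 * r - 9 /\ grid33 A.
Proof.
move=> r_ge3 Euni Epart Elin no3 _ injA AE le_cover.
have [-> [N [cardN cardNC disjA cardA]]] :=
  six_edges_extremal Euni Epart Elin no3 injA AE le_cover r_ge3.
split=> //; have [s [sl sr]] := @perm_of_half_set 3 N cardN cardNC.
exists s; apply: grid33_lines_of_disjoint => [i i' ii'|j j' jj'|i j].
- apply: disjA; first by rewrite !sl.
  by apply: contra_neq ii' => /perm_inj /(@lshift_inj 3 3).
- apply: disjA; first by rewrite !(negPf (sr _)).
  by apply: contra_neq jj' => /perm_inj /(@rshift_inj 3 3).
- exact: cardA.
Qed.
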